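(* Let $\frac12\le p<1$ and let $X_n$ be the number of correct guesses in the complete-feedback card guessing game after one asymmetric single-shelf shuffle with parameter $p$ of $n$ cards. Then the generating function $S(z,v)=\sum_{n\ge1}\mathbb E(v^{X_n})z^n$ is given by $$S(z,v)=\frac{-z\bigl(1+(v-1)(p-1)z\bigr)v}{zv-1+pv(v-1)(p-1)z^2},$$ and for all $n\ge3$ $$\mathbb E(X_n)=(1-p+p^2)\,n+3p-1-2p^2,$$ $$\mathbb V(X_n)=(1-p)p(3p^2-3p+1)\,n+p(1-p)(10p-8p^2-3).$$
   Context: Asymmetric single-shelf shuffle with parameter $p\in(0,1)$: an ordered deck of $n$ cards labelled $1,\dots,n$ (card $1$ on top, card $n$ at the bottom) is given. Cards are drawn one by one from the bottom of the deck (so in the order $n,n-1,\dots,1$) and put on an initially empty pile; each drawn card is placed, independently, at the top of the pile with probability $p$ and at the bottom of the pile with probability $1-p$. The final pile is the shuffled deck. Game: cards are drawn one after the other from the top of the shuffled deck. Before each draw the player guesses the label of the card; afterwards the card is shown (complete feedback). For $p\ge\frac12$ the player uses the following optimal strategy: the first guess is card $1$; as long as neither card $n-1$ nor card $n$ has been shown, the next guess is the label immediately following that of the most recently shown card; once one of the cards $n-1$ or $n$ has been shown, the player guesses the remaining (not yet shown) cards in descending order. $X_n$ denotes the total number of correct guesses; $\mathbb V$ denotes variance. The generating function identity is understood as an identity of formal power series in $z$. *)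

(* Defs.v *)
From HB Require Import structures.
From mathcomp Require Import all_boot all_order all_algebra.
From mathcomp Require Import all_classical all_reals all_analysis.

Set Implicit Arguments.
Unset Strict Implicit.
Unset Printing Implicit Defensive.

Import Order.TTheory GRing.Theory Num.Theory.

Local Open Scope classical_set_scope.
Local Open Scope ring_scope.

(* Mutual independence of a finite family: taking [A i := setT] for the indices
   outside a subfamily gives the product rule for every subfamily. *)
Definition independent_RVs d d' (T : measurableType d) (T' : measurableType d')
    (R : realType) (P : probability T R) (I : finType)
    (X : I -> {RV P >-> T'}) : Prop :=
  forall A : I -> set T', (forall i, measurable (A i)) ->
    P (\bigcap_i (X i @^-1` A i)) = (\prod_(i : I) P (X i @^-1` A i))%E.

Definition iid_bernoulli d (T : measurableType d) (R : realType)
    (P : probability T R) (p : R) (I : finType)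
    (X : I -> {RV P >-> bool}) : Prop :=
  independent_RVs X /\ forall i, distribution P (X i) =1 bernoulli_prob p.

(* The card labelled [i.+1] is represented by [i : 'I_n]; decks and piles are
   sequences of labels listed from top to bottom.  [top i] tells whether the
   card labelled [i.+1] is put at the top (or else the bottom) of the pile. *)
Definition place_card n (top : 'I_n -> bool) (pile : seq nat) (i : 'I_n) :=
  if top i then i.+1 :: pile else rcons pile i.+1.

Definition shelf_shuffle n (top : 'I_n -> bool) : seq nat :=
  foldl (place_card top) [::] (rev (enum 'I_n)).

(* The guess following the cards [shown] so far, listed in order of appearance.
   [last 0 shown] is the most recently shown card, or 0 at the first draw. *)
Definition guess (n : nat) (shown : seq nat) : nat :=
  if (n.-1 \in shown) || (n \in shown)
  then (\max_(1 <= k < n.+1 | k \notin shown) k)%N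
  else (last 0%N shown).+1.

Definition correct_guesses (n : nat) (deck : seq nat) : nat :=
  (\sum_(i < size deck) (nth 0 deck i == guess n (take i deck)))%N.

Definition score n (T : Type) (top : 'I_n -> T -> bool) (w : T) : nat :=
  correct_guesses n (shelf_shuffle (fun i => top i w)).

(* Formal power series over [K] are represented by their coefficients. *)
Definition fps_mul (K : fieldType) (a b : nat -> K) (n : nat) : K :=
  \sum_(i < n.+1) a i * b (n - i)%N.

(* Coefficients 0, ..., n-1 of a / b, by solving (a / b) * b = a for one
   coefficient after the other; meaningful when [b 0 != 0]. *)
Fixpoint fps_div_seq (K : fieldType) (a b : nat -> K) (n : nat) : seq K :=
  if n is m.+1 then
    let s := fps_div_seq a b m in
    rcons s ((a m - \sum_(i < m) s`_i * b (m - i)%N) / b 0%N)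
  else [::].

Definition fps_div (K : fieldType) (a b : nat -> K) (n : nat) : K :=
  (fps_div_seq a b n.+1)`_n.

Definition fps_of_poly (K : fieldType) (q : {poly K}) (n : nat) : K := q`_n.

Section FpsDivTheory.
Variables (K : fieldType) (a b : nat -> K).

Lemma size_fps_div_seq n : size (fps_div_seq a b n) = n.
Proof. by elim: n => //= n IHn; rewrite size_rcons IHn. Qed.

Lemma nth_fps_div_seq n i :
  (i < n)%N -> (fps_div_seq a b n)`_i = fps_div a b i.
Proof.
elim: n => // n IHn; rewrite ltnS leq_eqVlt => /orP[/eqP-> //|lt_in].
by rewrite /= nth_rcons size_fps_div_seq lt_in IHn.
Qed.

Lemma fps_div_rec n : fps_div a b n =
  (a n - \sum_(i < n) fps_div a b i * b (n - i)%N) / b 0%N.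
Proof.
rewrite {1}/fps_div /= nth_rcons size_fps_div_seq ltnn eqxx.
by under eq_bigr => i _ do rewrite nth_fps_div_seq //.
Qed.

Lemma fps_divP (q : nat -> K) : b 0%N != 0 ->
  (q =1 fps_div a b) <-> (fps_mul q b =1 a).
Proof.
move=> b0; split=> [qE n | qbE n].
  rewrite /fps_mul big_ord_recr /= subnn qE fps_div_rec divfK //.
  by under eq_bigr => i _ do rewrite qE; rewrite addrC subrK.
elim/ltn_ind: n => n IHn; rewrite fps_div_rec -(qbE n) /fps_mul big_ord_recr /=.
under [X in _ - X]eq_bigr => i _ do rewrite -IHn //.
by rewrite addrAC subrr add0r subnn mulfK.
Qed.

End FpsDivTheory.

(* Main.v *)
Require Import Defs.
From HB Require Import structures.
From mathcomp Require Import all_boot all_order all_algebra.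
From mathcomp Require Import all_classical all_reals all_analysis.
From mathcomp Require Import zify ring lra.

Set Implicit Arguments.
Unset Strict Implicit.
Unset Printing Implicit Defensive.

Import Order.TTheory GRing.Theory Num.Theory.

Local Open Scope classical_set_scope.
Local Open Scope ring_scope.

(* The shuffled deck lists the cards 1, ..., n-1 put on top in increasing order,
   then card n, then the remaining cards in decreasing order.  Regarding a
   fictitious card 0 as put on top, a card i < n put on top is guessed correctly
   iff card i-1 was put on top too; all cards put at the bottom are guessed
   correctly; and card n is guessed correctly iff card n-1 was put on top.  So
   the score only depends on the coin tosses through the two-state chain that
   remembers the previous toss.  The 2x2 transfer matrix of this chain has trace
   v and determinant p (1 - p) v (v - 1), which by Cayley-Hamilton gives the
   denominator of the generating function, and conditioning on the first toss
   gives closed forms of the first two moments. *)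

(** * The score of a deck as a function of the tosses *)

Section Game.
Local Open Scope nat_scope.

Fixpoint game n (shown rest : seq nat) : nat :=
  if rest is x :: r then (x == guess n shown) + game n (rcons shown x) r else 0.

Lemma game_sum n shown rest : game n shown rest =
  \sum_(i < size rest) (nth 0 rest i == guess n (shown ++ take i rest)).
Proof.
elim: rest shown => [|x r IHr] shown /=; first by rewrite big_ord0.
rewrite big_ord_recl /= cats0 IHr; congr (_ + _).
by apply: eq_bigr => i _; rewrite cat_rcons.
Qed.

Lemma correct_guesses_game n deck : correct_guesses n deck = game n [::] deck.
Proof. by rewrite game_sum. Qed.

Lemma guess_largest n shown x :
  (n.-1 \in shown) || (n \in shown) -> 1 <= x <= n -> x \notin shown ->
  (forall y, 1 <= y <= n -> y \notin shown -> y <= x) ->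
  guess n shown = x.
Proof.
rewrite /guess => -> x_n xNs x_max; apply/eqP.
rewrite eqn_leq; apply/andP; split.
  apply/bigmax_leqP_seq => y; rewrite mem_index_iota => y_n yNs.
  exact: x_max.
by apply: (leq_bigmax_seq (F := id)); rewrite ?mem_index_iota.
Qed.

(** The head of a descending list of all unseen cards is the largest unseen card, which is what the
    strategy names; drawing it preserves the hypotheses. *)
Lemma game_descending n shown rest :
  (n.-1 \in shown) || (n \in shown) -> sorted gtn rest ->
  (forall y, (y \in rest) = (1 <= y <= n) && (y \notin shown)) ->
  game n shown rest = size rest.
Proof.
elim: rest shown => //= x r IHr shown seen_n xr_sorted memr.
have /allP ltx : all (gtn x) r.
  by apply: order_path_min xr_sorted => a b c /= ba cb; apply: ltn_trans ba.
have := memr x; rewrite mem_head => /esym/andP[x_n xNs].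
rewrite (guess_largest seen_n x_n xNs) ?eqxx; last first.
  move=> y y_n yNs; have := memr y; rewrite y_n yNs inE.
  by case/orP => [/eqP-> //|/ltx/= /ltnW].
rewrite IHr ?(path_sorted xr_sorted) //.
  by rewrite !mem_rcons !inE; case/orP: seen_n => ->; rewrite !orbT.
move=> y; rewrite mem_rcons inE negb_or andbCA -memr inE.
case: (eqVneq y x) => //= ->; apply/negP => /ltx /=.
by rewrite ltnn.
Qed.

(* Score for the tosses [s] of the cards that precede card [n] and are still to
   come, [prev] being the toss of the card just before them. *)
Fixpoint run_score (prev : bool) (s : seq bool) : nat :=
  if s is b :: s' then ~~ (~~ prev && b) + run_score b s' else prev.

Lemma iota_rcons m n : iota m n.+1 = rcons (iota m n) (m + n).
Proof. by rewrite -addn1 iotaD cats1. Qed.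

(** Counting the fictitious card 0 as put on top makes the default 0 of [last] correct. The bound
    serves the induction step in which card [j.+1] is put at the bottom. *)
Lemma last_filter_iota (t : pred nat) j :
  t 0 -> last 0 (seq.filter t (iota 1 j)) <= j /\
  (last 0 (seq.filter t (iota 1 j)) == j) = t j.
Proof.
move=> t0; elim: j => [|j [IHle IHeq]]; first by rewrite t0.
rewrite iota_rcons filter_rcons add1n.
case: ifP => tj; first by rewrite last_rcons eqxx.
split; first exact: leqW IHle.
by rewrite ltn_eqF.
Qed.

(** Invariant once the top cards among 1, ..., [j] have been shown. The [count] term credits in
    advance the bottom cards among 1, ..., [j], which come after card [n] and are all guessed
    correctly. *)
Lemma game_shelf (t : pred nat) j m (n := (j + m).+1) : t 0 ->
  game n (seq.filter t (iota 1 j))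
    (seq.filter t (iota j.+1 m) ++
     n :: rev (seq.filter (predC t) (iota 1 (j + m)))) =
  run_score (t j) (map t (iota j.+1 m)) + count (predC t) (iota 1 j).
Proof.
move=> t0; rewrite {}/n.
elim: m j => [|m IHm] j; have [last_le last_eq] := last_filter_iota j t0.
  rewrite addn0 /=.
  have seen_le k : k \in seq.filter t (iota 1 j) -> k <= j.
    by rewrite mem_filter mem_iota add1n ltnS => /and3P[].
  have NS : j.+1 \notin seq.filter t (iota 1 j).
    by apply/negP => /seen_le; rewrite ltnn.
  rewrite game_descending; first 1 last.
  - by rewrite !mem_rcons !inE eqxx !orbT.
  - rewrite rev_sorted; apply: sorted_filter; first exact: ltn_trans.
    exact: iota_ltn_sorted.
  - move=> y; rewrite mem_rev mem_rcons inE !mem_filter mem_iota /=.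
    by rewrite add1n; case: (ltngtP y j.+1) => //=; case: (t y); lia.
  rewrite size_rev size_filter; congr (nat_of_bool _ + _).
  case tj: (t j); last first.
    rewrite /guess (negbTE NS) orbF mem_filter tj /= eqSS eq_sym.
    by rewrite last_eq tj.
  case: j last_le last_eq seen_le NS tj => [|j] last_le last_eq seen_le NS tj.
    by [].
  (* The card just below the largest one has been shown, so the strategy is already in its
     descending phase and names the largest card. *)
  rewrite (@guess_largest _ _ j.+2) ?eqxx //.
  - by rewrite mem_filter tj mem_iota; lia.
  - by lia.
  - by move=> y /andP[].
have NS k : j < k -> k \notin seq.filter t (iota 1 j).
  by move=> jk; rewrite mem_filter mem_iota; lia.
have := IHm j.+1; rewrite -addSnnS.
rewrite (iota_rcons 1 j) add1n -cats1 filter_cat count_cat /= addn0.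
case tj: (t j.+1) => /= IH; last first.
  (* A bottom card is not drawn now: its point moves from [run_score] to [count]. *)
  rewrite cats0 in IH; rewrite IH andbF /=. lia.
rewrite -cats1 IH addn0 andbT negbK addnA; congr (_ + _ + _).
(* The two largest cards both exceed [j], so the guess is still the successor of the last shown
   card. *)
rewrite /guess (negbTE (NS _ _)) ?(negbTE (NS _ _)) /=; [|lia..].
by rewrite eqSS eq_sym last_eq.
Qed.

Lemma shelf_shuffleE n (top : 'I_n -> bool) s :
  foldl (place_card top) [::] (rev s) =
  map (fun i : 'I_n => i.+1) (seq.filter top s) ++
  rev (map (fun i : 'I_n => i.+1) (seq.filter (predC top) s)).
Proof.
rewrite foldl_rev; elim: s => //= i s ->.
by rewrite /place_card; case: (top i) => //=; rewrite rev_cons rcons_cat.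
Qed.

(** Card [n.+1] is placed on the empty pile, so both values of its toss give the same deck; hence
    the [take n]. *)
Lemma correct_guesses_shelf_shuffle n (top : 'I_n.+1 -> bool) :
  correct_guesses n.+1 (shelf_shuffle top) =
  run_score true (take n [seq top i | i <- enum 'I_n.+1]).
Proof.
(* Tosses indexed by labels, with the fictitious card 0 on top. *)
pose t k := if k is k'.+1 then top (inord k') else true.
have topE : top =1 t \o (fun i : 'I_n.+1 => i.+1).
  by move=> i; rewrite /= inord_val.
have enumE : [seq (i : 'I_n.+1).+1 | i <- enum 'I_n.+1] = iota 1 n.+1.
  by rewrite (iotaDl 1 0) -val_enum_ord -map_comp; apply: eq_map => i.
rewrite /shelf_shuffle shelf_shuffleE (eq_filter topE).
have /eq_filter-> : predC top =1 predC t \o (fun i : 'I_n.+1 => i.+1).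
  by move=> i; rewrite /= inord_val.
rewrite -!filter_map (eq_map topE) map_comp enumE.
rewrite correct_guesses_game iota_rcons add1n -cats1 map_cat.
rewrite !filter_cat /= take_size_cat ?size_map ?size_iota //.
have := @game_shelf t 0 n isT; rewrite /= add0n addn0 => <-.
by case: ifP => _; rewrite /= ?cats0 ?rev_cat -?catA.
Qed.

End Game.

(** * Means over finitely many tosses and moments of the two-state chain *)

Section CoinMean.
Variables (R : realType) (p : R).

(** Splitting off the first toss matches the recursion of [run_score]. *)
Fixpoint coin_mean (n : nat) (f : seq bool -> R) : R :=
  if n is m.+1 then
    p * coin_mean m (f \o cons true) + (1 - p) * coin_mean m (f \o cons false)
  else f [::].

Lemma eq_coin_mean n f g : f =1 g -> coin_mean n f = coin_mean n g.
Proof.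
elim: n f g => [|n IHn] f g fg /=; first exact: fg.
by congr (_ * _ + _ * _)%R; apply: IHn => s; apply: fg.
Qed.

Lemma coin_mean_cst n c : coin_mean n (fun=> c) = c.
Proof.
by elim: n => //= n IHn; rewrite -[X in p * X + _]/(coin_mean n (fun=> c))
  -[X in _ + _ * X]/(coin_mean n (fun=> c)) IHn; ring.
Qed.

Lemma coin_meanD n f g :
  coin_mean n (fun s => f s + g s) = coin_mean n f + coin_mean n g.
Proof.
elim: n f g => //= n IHn f g.
rewrite (IHn (f \o cons true) (g \o cons true)).
by rewrite (IHn (f \o cons false) (g \o cons false)); ring.
Qed.

Lemma coin_meanZ n c f : coin_mean n (fun s => c * f s) = c * coin_mean n f.
Proof.
elim: n f => //= n IHn f.
by rewrite (IHn (f \o cons true)) (IHn (f \o cons false)); ring.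
Qed.

(** The weights of the last toss sum to 1. This discards the toss of the largest card. *)
Lemma coin_mean_take n f :
  coin_mean n.+1 (f \o take n) = coin_mean n f.
Proof.
elim: n f => [|n IHn] f; first by rewrite /=; ring.
rewrite [LHS]/= -/(coin_mean n.+1 _) -/(coin_mean n.+1 _).
by rewrite (IHn (f \o cons true)) (IHn (f \o cons false)).
Qed.

Definition coin_weight (b : bool) : R := if b then p else 1 - p.

Lemma coin_mean_sum n f : coin_mean n f =
  \sum_(s : n.-tuple bool) f s * \prod_(b <- s) coin_weight b.
Proof.
elim: n f => [|n IHn] f /=.
  rewrite (big_pred1 [tuple]) ?big_nil ?mulr1 // => s.
  by apply/esym/eqP; exact: tuple0.
rewrite (reindex (fun bs : bool * n.-tuple bool => [tuple of bs.1 :: bs.2])) /=.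
  rewrite -(pair_bigA _ (fun b (s : n.-tuple bool) =>
    f (b :: s) * \prod_(c <- b :: s) coin_weight c)) /= big_bool !IHn !mulr_sumr.
  by congr (_ + _); apply: eq_bigr => s _; rewrite big_cons /= mulrCA.
exists (fun s => (thead s, [tuple of behead s])) => [[b s] _|s _] /=.
  by congr (_, _); apply/val_inj.
by rewrite -tuple_eta.
Qed.

(** By [gS] the transfer matrix has rows (p v, (1 - p) v) and (p, (1 - p) v); this is its
    Cayley-Hamilton relation read in the first coordinate. *)
Lemma coin_gf_rec v n
    (g := fun b m => coin_mean m (fun s => v ^+ run_score b s)) :
  g true n.+2 = v * g true n.+1 + p * v * (v - 1) * (p - 1) * g true n.
Proof.
have gS b m :
    g b m.+1 = p * v ^+ (b : nat) * g true m + (1 - p) * v * g false m.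
  rewrite /g /= -![_ * _ * coin_mean _ _]mulrA.
  congr (_ * _ + _ * _); rewrite -coin_meanZ;
    apply: eq_coin_mean => s /=; rewrite exprD.
    by rewrite andbT negbK.
  by rewrite andbF expr1.
by rewrite [LHS]gS (gS false) (gS true) expr1 expr0; ring.
Qed.

(** Each of the [m - 1] adjacent pairs of tosses loses a point with probability [p * (1 - p)], the
    first toss loses one with probability [p] if [b] is false, and the final term of [run_score]
    adds [p]. *)
Lemma mean_run_score n b (m := n.+1) :
  coin_mean m (fun s => (run_score b s)%:R) =
  m%:R - (m%:R - 1) * p * (1 - p) + (if b then p else 0).
Proof.
have meanS b' k : coin_mean k.+1 (fun s => (run_score b' s)%:R) =
    p * (b'%:R + coin_mean k (fun s => (run_score true s)%:R)) +
    (1 - p) * (1 + coin_mean k (fun s => (run_score false s)%:R)).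
  rewrite /= -[b'%:R in RHS](coin_mean_cst k) 
    -[X in _ = _ + _ * (X + _)](coin_mean_cst k).
  rewrite -!coin_meanD; congr (_ * _ + _ * _); apply: eq_coin_mean => s /=.
    by rewrite andbT negbK natrD.
  by rewrite andbF natrD.
rewrite {}/m; elim: n b => [|n IHn] b.
  by rewrite meanS /=; case: b => /=; rewrite ?mulr1n ?mulr0n; ring.
rewrite meanS !IHn -![n.+2%:R]natr1 -![n.+1%:R]natr1.
by case: b => /=; rewrite ?mulr1n ?mulr0n; ring.
Qed.

(** Squared mean plus variance. The variance formula starts at two tosses, that is, at three
    cards. *)
Lemma mean_sqr_run_score n b (m := n.+2) (q := p * (1 - p)) :
  coin_mean m (fun s => (run_score b s)%:R ^+ 2) =
  (m%:R - (m%:R - 1) * q + (if b then p else 0)) ^+ 2 +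
  q * (m%:R - 1 - (3 * m%:R - 5) * q + (if b then 2 * p - 1 else 0)).
Proof.
have sqrD k c (f : seq bool -> R) : coin_mean k (fun s => (c + f s) ^+ 2) =
    c ^+ 2 + 2 * c * coin_mean k f + coin_mean k (fun s => f s ^+ 2).
  rewrite -[c ^+ 2 in RHS](coin_mean_cst k) -coin_meanZ -!coin_meanD.
  by apply: eq_coin_mean => s; ring.
have sqrS b' k : coin_mean k.+1 (fun s => (run_score b' s)%:R ^+ 2) =
    p * coin_mean k (fun s => (b'%:R + (run_score true s)%:R) ^+ 2) +
    (1 - p) * coin_mean k (fun s => (1 + (run_score false s)%:R) ^+ 2).
  rewrite /=; congr (_ * _ + _ * _); apply: eq_coin_mean => s /=.
    by rewrite andbT negbK natrD.
  by rewrite andbF natrD.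
rewrite {}/m {}/q; elim: n b => [|n IHn] b.
  rewrite sqrS !sqrD !mean_run_score !sqrS /=.
  by case: b => /=; rewrite ?mulr1n ?mulr0n; ring.
rewrite sqrS !sqrD !mean_run_score !IHn -![n.+3%:R]natr1 -![n.+2%:R]natr1.
by case: b => /=; rewrite ?mulr1n ?mulr0n; ring.
Qed.

End CoinMean.

(** * From the probability space to finite coin means *)

Section Law.
Context d (T : measurableType d) (R : realType) (P : probability T R).
Variables (p : R) (n : nat) (top : 'I_n -> {RV P >-> bool}).
Hypotheses (p01 : 0 <= p <= 1) (top_iid : iid_bernoulli p top).

Let bits w : seq bool := [seq top i w | i <- enum 'I_n].

Let cell (s : n.-tuple bool) : set T :=
  \bigcap_i (top i @^-1` [set tnth s i]).

Let measurable_cell s : measurable (cell s).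
Proof.
apply: fin_bigcap_measurable => [|i _]; first exact: finite_finset.
by rewrite -[X in measurable X]setTI; exact: measurable_funP.
Qed.

Let prob_cell s : P (cell s) = (\prod_(b <- s) coin_weight p b)%:E.
Proof.
case: top_iid => indep law; rewrite indep // -prodEFin big_tuple.
apply: eq_bigr => i _; have := law i [set tnth s i].
rewrite /distribution /pushforward => ->; rewrite bernoulli_probE //.
case: (tnth s i); rewrite /coin_weight /= !diracE.
all: by rewrite !classical_sets.in_set1 /= ?mule1 ?mule0 ?adde0 ?add0e.
Qed.

Let cellP s w : cell s w <-> bits w = s :> seq bool.
Proof.
rewrite -(map_tnth_enum s); split => [cw|/eq_in_map bE i _].
  by apply: eq_map => i; exact: cw.
by apply: bE; rewrite mem_enum.
Qed.

(** The cells partition the space, so [f \o bits] is a finite combination of their indicators, with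
    integrals given by [prob_cell]. *)
Lemma expectation_coins (f : seq bool -> R) :
  'E_P[f \o bits]%E = (coin_mean p n f)%:E.
Proof.
have fE w : (f (bits w))%:E =
    (\sum_(s : n.-tuple bool) (f s)%:E * (\1_(cell s) w)%:E)%E.
  have sz : size (bits w) == n by rewrite size_map size_enum_ord.
  rewrite (bigD1 (Tuple sz)) //= big1 ?adde0 => [|s sN].
    by rewrite indicE mem_set ?mule1 //; apply/cellP.
  rewrite indicE memNset ?mule0 // => /cellP bE.
  by move/eqP: sN; apply; apply/val_inj.
have icell s : P.-integrable setT (fun w => (\1_(cell s) w)%:E).
  by apply: integrable_indic => //; exact: fin_num_fun_lty.
rewrite coin_mean_sum unlock /=; under eq_integral do rewrite fE.
rewrite integral_sum // => [|s]; last exact: integrableZl.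
rewrite -sumEFin; apply: eq_bigr => s _.
by rewrite integralZl // integral_indic // setIT EFinM -prob_cell.
Qed.

End Law.

Theorem mainTheorem9 (R : realType) (p : R) (p_range : 1 / 2 <= p < 1)
    (d : nat -> measure_display) (T : forall n, measurableType (d n))
    (P : forall n, probability (T n) R)
    (top : forall n, 'I_n -> {RV (P n) >-> bool})
    (top_iid : forall n, iid_bernoulli p (@top n)) :
  let X (n : nat) (w : T n) : nat := score (@top n) w in
  (forall v : R,
     let S (n : nat) : R :=
       if n == 0%N then 0 else fine ('E_(P n)[fun w => (v ^+ X n w)%R])%E in
     S =1 fps_div
       (fps_of_poly (- 'X * (1 + ((v - 1) * (p - 1)) *: 'X) * v%:P))
       (fps_of_poly (v *: 'X - 1 + (p * v * (v - 1) * (p - 1)) *: 'X^2))) /\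
  (forall n : nat, (3 <= n)%N ->
     ('E_(P n)[fun w => (X n w)%:R%R] =
        ((1 - p + p ^+ 2) * n%:R + 3 * p - 1 - 2 * p ^+ 2)%R%:E)%E /\
     ('V_(P n)[fun w => (X n w)%:R%R] =
        ((1 - p) * p * (3 * p ^+ 2 - 3 * p + 1) * n%:R
         + p * (1 - p) * (10 * p - 8 * p ^+ 2 - 3))%R%:E)%E).
Proof.
move=> X; have p01 : 0 <= p <= 1 by lra.
have meanX n (h : nat -> R) : 'E_(P n.+1)[fun w => h (X n.+1 w)]%E =
    (coin_mean p n (fun s => h (run_score true s)))%:E.
  rewrite -coin_mean_take -(expectation_coins p01 (top_iid n.+1)).
  by congr expectation; apply/funext => w; rewrite /X /score
    correct_guesses_shelf_shuffle.
split=> [v S|[//|n] n_ge3].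
  have SE n : S n.+1 = coin_mean p n (fun s => v ^+ run_score true s).
    by rewrite /S /= (meanX n (fun k => v ^+ k)).
  (* The denominator has constant coefficient -1, so it can be cleared. *)
  apply/fps_divP.
    by rewrite /fps_of_poly !coefE /= !mulr0 addr0 sub0r oppr_eq0 oner_neq0.
  have numE : - 'X * (1 + ((v - 1) * (p - 1)) *: 'X) * v%:P =
      (- v) *: 'X + (- (v * (v - 1) * (p - 1))) *: 'X^2 :> {poly R}.
    by rewrite -!mul_polyC !(polyCN, polyCM, polyCB, polyC1); ring.
  rewrite numE => n; rewrite /fps_mul /fps_of_poly.
  (* Degrees below 3 involve the numerator or [S 0]; from degree 3 on, the identity is
     [coin_gf_rec], shifted since [n.+1] cards use [n] tosses. *)
  case: n => [|[|[|n]]].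
  - by rewrite big_ord1 !coefE /= /S /=; ring.
  - rewrite !big_ord_recr big_ord0 /= SE !coefE /= /S /=; ring.
  - rewrite !big_ord_recr big_ord0 /= !SE !coefE /= /S /=; ring.
  rewrite !big_ord_recr /= big1 => [|i _]; last first.
    rewrite !coefE.
    have -> : (n.+3 - i == 1)%N = false by have := ltn_ord i; lia.
    have -> : (n.+3 - i == 0)%N = false by have := ltn_ord i; lia.
    have -> : (n.+3 - i == 2)%N = false by have := ltn_ord i; lia.
    by rewrite /=; ring.
  rewrite !coefE !SE coin_gf_rec.
  have -> : (n.+3 - n = 3)%N by lia.
  have -> : (n.+3 - n.+1 = 2)%N by lia.
  have -> : (n.+3 - n.+2 = 1)%N by lia.
  by rewrite subnn /=; ring.
case: n n_ge3 => [//|[//|n] _].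
have EX : 'E_(P n.+3)[fun w => (X n.+3 w)%:R%R]%E =
    ((1 - p + p ^+ 2) * n.+3%:R + 3 * p - 1 - 2 * p ^+ 2)%R%:E.
  rewrite (meanX _ (fun k => k%:R)) mean_run_score; congr EFin.
  by rewrite -[n.+3%:R]natr1; ring.
split=> //; rewrite /variance unlock EX /=.
set c : R := (X in cst X).
transitivity ('E_(P n.+3)[fun w => (((X n.+3 w)%:R - c) ^+ 2)%R]%E).
  by congr expectation; apply/funext => w; rewrite /= expr2.
rewrite (meanX _ (fun k => (k%:R - c) ^+ 2)); congr EFin.
(* Expanding the square around the mean [c] leaves only the first two moments. *)
rewrite (@eq_coin_mean _ _ _ _ (fun s => c ^+ 2 +
  ((- 2 * c) * (run_score true s)%:R + (run_score true s)%:R ^+ 2))); last first.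
  by move=> s; ring.
rewrite !coin_meanD coin_mean_cst coin_meanZ mean_run_score mean_sqr_run_score.
by rewrite /c -[n.+3%:R]natr1; ring.
Qed.
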